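(* Let $d\in\mathbb{N}$ and let $p:\mathbb{Z}^d\to[0,1)$ satisfy $\sum_{x}p(x)=1$, $p(x)=0$ for $|x|>M$ for some $M<\infty$, and the strong aperiodicity property: for every $u\in\mathbb{Z}^d$ the smallest additive subgroup of $\mathbb{Z}^d$ containing $\{u+x:p(x)>0\}$ is $\mathbb{Z}^d$. Write $p(x,y)=p(y-x)$ and let $m_p=\sum_{x\in\mathbb{Z}^d}x\,p(x)\in\mathbb{R}^d$. Let $\{\xi_t(x)\}_{t\in\mathbb{Z},x\in\mathbb{Z}^d}$ be i.i.d. real random variables with mean $0$ and finite variance. For each $n$ let $h^n_t=\{h^n_t(x)\}_{x\in\mathbb{Z}^d}$, $t\in\mathbb{Z}_+$, be a harness process, i.e. $h^n_{t+1}(x)=\sum_{y}p(x,y)h^n_t(y)+\xi_{t+1}(x)$ with $\{\xi_{s}\}_{s\ge 1}$ independent of $h^n_0$. Let $u_0:\mathbb{R}^d\to\mathbb{R}$ be continuous and define $u(t,x)=u_0(x+t m_p)$. Assume that for all $\varepsilon>0$ and $R<\infty$, \[\lim_{n\to\infty}\mathbf{P}\Bigl\{\sup_{x\in\mathbb{R}^d:|x|\le R}\bigl|n^{-1}h^n_0(\lfloor nx\rfloor)-u_0(x)\bigr|\ge\varepsilon\Bigr\}=0.\] Then for all $\varepsilon>0$ and $(t,x)\in\mathbb{R}_+\times\mathbb{R}^d$, \[\lim_{n\to\infty}\mathbf{P}\bigl\{\bigl|n^{-1}h^n_{\lfloor nt\rfloor}(\lfloor nx\rfloor)-u(t,x)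\bigr|\ge\varepsilon\bigr\}=0.\]
   Context: $\lfloor nx\rfloor$ for $x\in\mathbb{R}^d$ denotes the componentwise integer part. $\mathbf{P}$ denotes the probability measure of the processes. *)

(* Defs.v *)
From HB Require Import structures.
From mathcomp Require Import all_boot all_order all_algebra.
From mathcomp Require Import all_classical all_reals all_analysis.
Set Implicit Arguments. Unset Strict Implicit. Unset Printing Implicit Defensive.
Import Order.TTheory GRing.Theory Num.Theory.
Import numFieldNormedType.Exports.
Local Open Scope classical_set_scope.
Local Open Scope ring_scope.

(* Finite-support sum over all of Z^d (fsbig): for finitely supported summands
   this is the usual sum. *)
Definition harness_step (R : realType) (d : nat) (p : 'rV[int]_d -> R)
  (h : 'rV[int]_d -> R) (x : 'rV[int]_d) : R :=
  (\sum_(y \in [set: 'rV[int]_d]) p (y - x) * h y)%R.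

Definition mean_vec (R : realType) (d : nat) (p : 'rV[int]_d -> R) : 'rV[R]_d :=
  (\sum_(z \in [set: 'rV[int]_d]) p z *: map_mx (fun k : int => k%:~R) z)%R.

Definition floor_vec (R : realType) (d : nat) (x : 'rV[R]_d) : 'rV[int]_d :=
  map_mx (fun r : R => Num.floor r) x.

Definition add_subgroup (d : nat) (G : set 'rV[int]_d) : Prop :=
  G 0 /\ (forall a b, G a -> G b -> G (a - b)).

Definition gen_subgroup (d : nat) (S : set 'rV[int]_d) : set 'rV[int]_d :=
  [set z | forall G, add_subgroup G -> S `<=` G -> G z].

Definition strongly_aperiodic (R : realType) (d : nat) (p : 'rV[int]_d -> R) : Prop :=
  forall u : 'rV[int]_d, gen_subgroup [set u + x | x in [set x | 0 < p x]] = setT.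

Definition mutually_independent (dT : measure_display) (T : measurableType dT)
  (R : realType) (P : probability T R) (I : eqType) (X : I -> T -> R) : Prop :=
  forall (J : seq I) (B : I -> set R), uniq J -> (forall i, measurable (B i)) ->
    P [set w | forall i, i \in J -> B i (X i w)] =
    (\prod_(i <- J) P (X i @^-1` B i))%E.

Definition identically_distributed (dT : measure_display) (T : measurableType dT)
  (R : realType) (P : probability T R) (I : Type) (X : I -> T -> R) : Prop :=
  forall i j (B : set R), measurable B -> P (X i @^-1` B) = P (X j @^-1` B).

(* independence of two families of random variables (of the sigma-algebras they
   generate), stated on the generating pi-system of finite cylinder events *)
Definition independent_families (dT : measure_display) (T : measurableType dT)
  (R : realType) (P : probability T R) (I J : eqType)
  (X : I -> T -> R) (Y : J -> T -> R) : Prop :=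
  forall (I0 : seq I) (J0 : seq J) (B : I -> set R) (C : J -> set R),
    (forall i, measurable (B i)) -> (forall j, measurable (C j)) ->
    let A1 := [set w | forall i, i \in I0 -> B i (X i w)] in
    let A2 := [set w | forall j, j \in J0 -> C j (Y j w)] in
    P (A1 `&` A2) = (P A1 * P A2)%E.

(* Main.v *)
Require Import Defs.
From HB Require Import structures.
From mathcomp Require Import all_boot all_order all_algebra.
From mathcomp Require Import all_classical all_reals all_analysis measurable_realfun.
From mathcomp Require Import ring lra.
Set Implicit Arguments. Unset Strict Implicit. Unset Printing Implicit Defensive.
Import Order.TTheory GRing.Theory Num.Theory.
Import numFieldNormedType.Exports.
Local Open Scope classical_set_scope.
Local Open Scope ring_scope.

(* Let A be the averaging operator (A f)(x) = sum_z p(z) f(x + z). Unrolling the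
   recursion, h_t = A^t h_0 + noise_t, where noise_t is a linear combination of
   the variables xi_s, s <= t. Since p is a probability, Jensen's inequality and
   the orthogonality of noise_t to xi_{t+1} give E noise_t(x)^2 <= t Var(xi), so
   that noise_{nt} / n vanishes in probability by Chebyshev's inequality.
   For the other term, |u0 - u0(c)| is bounded on a ball by e + B |. - c|^2, and A
   acts exactly on quadratic functions: A^t shifts the mean by t m_p and adds t
   times the variance of p. With c = x + t m_p, rescaling by n makes the quadratic
   contribution O(1/n). *)

(** * The averaging operator of a finite-range walk *)

Definition walk_avg (R : realType) (d : nat) (S : seq 'rV[int]_d)
  (p : 'rV[int]_d -> R) (f : 'rV[int]_d -> R) (x : 'rV[int]_d) : R :=
  \sum_(z <- S) p z * f (x + z).

Lemma fsbig_seqT (V : nmodType) (I : choiceType) (S : seq I) (F : I -> V) :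
  uniq S -> (forall z, z \notin S -> F z = 0) ->
  \sum_(z \in [set: I]) F z = \sum_(z <- S) F z.
Proof.
move=> uS F0; rewrite (fsbigE S) //; last by move=> z _; apply: F0.
by apply: eq_bigl => z; rewrite in_setT.
Qed.

(* A finitely supported sum is 0 by convention when the support is infinite. *)
Lemma fsum1_support (R : realType) (I : choiceType) (p : I -> R) :
  \sum_(x \in [set: I]) p x = 1 ->
  exists S : seq I, [/\ uniq S, forall z, z \notin S -> p z = 0
    & \sum_(z <- S) p z = 1].
Proof.
case: finite_supportP => [_|X _ F0 XE].
  by rewrite big_nil => /esym/eqP; rewrite oner_eq0.
move=> p1; exists (finmap.enum_fset X); split => //.
by move=> z zX; apply: F0.
Qed.

Lemma harness_stepE (R : realType) (d : nat) (S : seq 'rV[int]_d)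
  (p f : 'rV[int]_d -> R) (x : 'rV[int]_d) :
  uniq S -> (forall z, z \notin S -> p z = 0) ->
  harness_step p f x = walk_avg S p f x.
Proof.
move=> uS p0; rewrite /harness_step (reindex_fsbigT (fun z => x + z)); last first.
  by exists (fun y => - x + y) => z; rewrite ?addKr ?addNKr.
rewrite (fsbig_seqT (S := S)) //; last first.
  by move=> z zS; rewrite [x + z]addrC addrK p0 // mul0r.
by apply: eq_bigr => z _; rewrite {1}[x + z]addrC addrK.
Qed.

Lemma mean_vecE (R : realType) (d : nat) (S : seq 'rV[int]_d)
  (p : 'rV[int]_d -> R) (i : 'I_d) :
  uniq S -> (forall z, z \notin S -> p z = 0) ->
  mean_vec p ord0 i = \sum_(z <- S) p z * (z ord0 i)%:~R.
Proof.
move=> uS p0; rewrite /mean_vec (fsbig_seqT (S := S)) //; last first.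
  by move=> z zS; rewrite p0 // scale0r.
by rewrite summxE; apply: eq_bigr => z _; rewrite !mxE.
Qed.

Lemma walk_avg_eq (R : realType) (d : nat) (S : seq 'rV[int]_d)
  (p f g : 'rV[int]_d -> R) x : f =1 g -> walk_avg S p f x = walk_avg S p g x.
Proof. by move=> fg; apply: eq_bigr => z _; rewrite fg. Qed.

Lemma walk_avgD (R : realType) (d : nat) (S : seq 'rV[int]_d)
  (p f g : 'rV[int]_d -> R) x :
  walk_avg S p (fun y => f y + g y) x = walk_avg S p f x + walk_avg S p g x.
Proof.
by rewrite /walk_avg -big_split /=; apply: eq_bigr => z _; rewrite mulrDr.
Qed.

Lemma walk_avgZ (R : realType) (d : nat) (S : seq 'rV[int]_d)
  (p f : 'rV[int]_d -> R) (a : R) x :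
  walk_avg S p (fun y => a * f y) x = a * walk_avg S p f x.
Proof.
by rewrite /walk_avg mulr_sumr; apply: eq_bigr => z _; rewrite mulrCA.
Qed.

Lemma iter_walk_avgZ (R : realType) (d : nat) (S : seq 'rV[int]_d)
  (p f : 'rV[int]_d -> R) (a : R) n x :
  iter n (walk_avg S p) (fun y => a * f y) x = a * iter n (walk_avg S p) f x.
Proof.
elim: n x => [//|n IH] x.
by rewrite 2!iterS -walk_avgZ; apply: walk_avg_eq.
Qed.

(** Steps are bounded by [M], so [n] iterations only see the box of radius [n%:R * M] around [x];
    each induction step spends one [M] of that radius. *)
Lemma iter_walk_avg_le (R : realType) (d : nat) (S : seq 'rV[int]_d)
  (p f g : 'rV[int]_d -> R) (M : R) (n : nat) (x : 'rV[int]_d) :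
  (forall z, 0 <= p z) ->
  (forall z i, z \in S -> `|(z ord0 i)%:~R| <= M) ->
  (forall y : 'rV[int]_d, (forall i, `|(y ord0 i)%:~R - (x ord0 i)%:~R| <= n%:R * M) ->
     f y <= g y) ->
  iter n (walk_avg S p) f x <= iter n (walk_avg S p) g x.
Proof.
move=> p0 SM; elim: n x => [|n IH] x fg.
  by apply: fg => i; rewrite subrr normr0 mul0r.
rewrite !iterS /walk_avg big_seq [leRHS]big_seq; apply: ler_sum => z zS.
apply: ler_wpM2l => //; apply: IH => y yz; apply: fg => i.
have := yz i; rewrite !mxE rmorphD /= => yzi.
have -> : (y ord0 i)%:~R - (x ord0 i)%:~R
  = ((y ord0 i)%:~R - ((x ord0 i)%:~R + (z ord0 i)%:~R)) + (z ord0 i)%:~R :> R.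
  by rewrite opprD addrA subrK.
rewrite (le_trans (ler_normD _ _)) // -natr1 mulrDl mul1r.
by apply: lerD => //; apply: SM.
Qed.

(** * Exact action of the average on quadratic functions *)

Definition walk_mean (R : realType) (d : nat) (S : seq 'rV[int]_d)
  (p : 'rV[int]_d -> R) (i : 'I_d) : R :=
  \sum_(z <- S) p z * (z ord0 i)%:~R.

(** When the weights sum to 1, this is the variance of one coordinate of a step. Only sums of
    coordinatewise squares get averaged, so no covariances between coordinates arise. *)
Definition walk_var (R : realType) (d : nat) (S : seq 'rV[int]_d)
  (p : 'rV[int]_d -> R) (i : 'I_d) : R :=
  \sum_(z <- S) p z * (z ord0 i)%:~R ^+ 2 - walk_mean S p i ^+ 2.

(** Squared bias plus variance after [n] steps: each average moves the centre by [walk_mean] and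
    adds [walk_var], and it fixes constants. *)
Lemma iter_walk_avg_sqr (R : realType) (d : nat) (S : seq 'rV[int]_d)
  (p : 'rV[int]_d -> R) (K b : R) (c : 'I_d -> R) (n : nat) (x : 'rV[int]_d) :
  \sum_(z <- S) p z = 1 ->
  iter n (walk_avg S p)
    (fun y => K + b * \sum_i ((y ord0 i)%:~R - c i) ^+ 2) x =
  K + b * \sum_i (((x ord0 i)%:~R + n%:R * walk_mean S p i - c i) ^+ 2
                  + n%:R * walk_var S p i).
Proof.
move=> p1; elim: n x => [|n IH] x.
  by congr (_ + _ * _); apply: eq_bigr => i _; rewrite !mul0r !addr0.
rewrite iterS (walk_avg_eq _ _ _ IH) walk_avgD; congr (_ + _).
  by rewrite /walk_avg -mulr_suml p1 mul1r.
rewrite walk_avgZ; congr (_ * _); rewrite /walk_avg.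
under eq_bigr do rewrite mulr_sumr.
rewrite exchange_big /=; apply: eq_bigr => i _.
set s := (x ord0 i)%:~R + n%:R * walk_mean S p i - c i.
(* The square is expanded around [s] and sorted by the moments of [p] of order 0, 1 and 2. *)
transitivity (\sum_(z <- S) ((s ^+ 2 + n%:R * walk_var S p i) * p z
   + (2 * s) * (p z * (z ord0 i)%:~R) + p z * (z ord0 i)%:~R ^+ 2)).
  by apply: eq_bigr => z _; rewrite !mxE rmorphD /= /s; ring.
rewrite !big_split /= -!mulr_sumr p1 -/(walk_mean S p i).
have -> : \sum_(z <- S) p z * (z ord0 i)%:~R ^+ 2
  = walk_var S p i + walk_mean S p i ^+ 2 by rewrite /walk_var subrK.
by rewrite /s -natr1; ring.
Qed.

(* [g] lies between two quadratic functions, on which the iterated average is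
   explicit; finite range confines the comparison to a box. *)
Lemma iter_walk_avg_dist (R : realType) (d : nat) (S : seq 'rV[int]_d)
  (p g : 'rV[int]_d -> R) (M L a b : R) (c : 'I_d -> R) (n : nat)
  (x : 'rV[int]_d) :
  (forall z, 0 <= p z) -> \sum_(z <- S) p z = 1 ->
  (forall z i, z \in S -> `|(z ord0 i)%:~R| <= M) ->
  (forall y : 'rV[int]_d, (forall i, `|(y ord0 i)%:~R - (x ord0 i)%:~R| <= n%:R * M) ->
     `|g y - L| <= a + b * \sum_i ((y ord0 i)%:~R - c i) ^+ 2) ->
  `|iter n (walk_avg S p) g x - L| <=
  a + b * \sum_i (((x ord0 i)%:~R + n%:R * walk_mean S p i - c i) ^+ 2
                  + n%:R * walk_var S p i).
Proof.
move=> p0 p1 SM gL; rewrite ler_distl.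
set Q := \sum_i _.
(* Both bounds must have the form constant plus multiple of [Q], with multiple [- b] below and [b]
   above, to be read as iterated averages. *)
have -> : L - (a + b * Q) = (L - a) + (- b) * Q by ring.
rewrite addrA; rewrite -!(iter_walk_avg_sqr _ _ _ n x p1).
apply/andP; split; apply: (iter_walk_avg_le (M := M)) => // y /gL;
  rewrite ler_distl => /andP[]; lra.
Qed.

(** * The sup norm, and a quadratic modulus of continuity *)

Lemma norm_coord_le (R : realType) (d : nat) (v : 'rV[R]_d) (i : 'I_d) :
  `|v ord0 i| <= `|v|.
Proof.
rewrite [leRHS]mx_normrE.
exact: (le_bigmax _ (fun ij : 'I_1 * 'I_d => `|v ij.1 ij.2|) (ord0, i)).
Qed.

Lemma norm_rV_le (R : realType) (d : nat) (v : 'rV[R]_d) (r : R) :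
  0 <= r -> (forall i, `|v ord0 i| <= r) -> `|v| <= r.
Proof.
move=> r0 vr; rewrite [leLHS]mx_normrE; apply/bigmax_leP; split => // -[j i] _ /=.
by rewrite (ord1 j).
Qed.

Lemma norm_rV_lt (R : realType) (d : nat) (v : 'rV[R]_d) (r : R) :
  0 < r -> (forall i, `|v ord0 i| < r) -> `|v| < r.
Proof.
move=> r0 vr; rewrite [ltLHS]mx_normrE; apply/bigmax_ltP; split => // -[j i] _ /=.
by rewrite (ord1 j).
Qed.

(** Near [c], continuity bounds the deviation by [e]; away from [c], the deviation is bounded by
    compactness while the squared distance is bounded below. *)
Lemma continuous_le_sqr (R : realType) (d : nat) (u : 'rV[R]_d -> R)
  (c : 'rV[R]_d) (r e : R) :
  continuous u -> 0 < e ->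
  exists2 B : R, 0 <= B & forall y : 'rV[R]_d, `|y| <= r ->
    `|u y - u c| <= e + B * \sum_i (y ord0 i - c ord0 i) ^+ 2.
Proof.
move=> cu e0.
have : compact [set v : 'rV[R]_d | forall i, `[(- r), r]%classic (v ord0 i)].
  apply: (@rV_compact _ _ (fun=> `[(- r), r]%classic)) => i.
  exact: segment_compact.
move/(continuous_compact (continuous_subspaceT cu))/compact_bounded.
move=> -[K0 [_ /(_ (`|K0| + 1))]].
(* Boundedness holds for every constant strictly above [K0]; this one is also nonnegative. *)
rewrite (le_lt_trans (ler_norm _)) ?ltrDl // => /(_ isT) uK.
set K := `|K0| + 1 in uK.
have K_ge0 : 0 <= K by rewrite addr_ge0.
have /cvgrPdist_lt/(_ _ e0)/nbhs_ballP[del /= del0] := cu c.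
rewrite mx_norm_ball => udel.
(* A squared distance of [del ^+ 2] then already yields [K] plus the absolute value of [u c], the
   largest possible deviation on the ball. *)
exists ((K + `|u c|) / del ^+ 2).
  by rewrite divr_ge0 // ?sqr_ge0 // addr_ge0.
move=> y yr.
have S0 : 0 <= \sum_i (y ord0 i - c ord0 i) ^+ 2.
  by apply: sumr_ge0 => i _; apply: sqr_ge0.
have [near|far] := pselect (`|c - y| < del).
  have /ltW uyc : `|u c - u y| < e by apply: udel.
  rewrite distrC (le_trans uyc) //.
  by rewrite lerDl mulr_ge0 // divr_ge0 ?sqr_ge0 // addr_ge0.
(* The norm is a maximum over coordinates, so a single coordinate accounts for the distance. *)
have [i /negP ci] : exists i, ~ (`|(c - y) ord0 i| < del).
  by apply/existsNP => cy; apply/far/norm_rV_lt.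
rewrite -leNgt !mxE distrC in ci.
have uy : `|u y| <= K.
  apply: uK; exists y => // j /=; rewrite in_itv /= -ler_norml.
  exact: le_trans (norm_coord_le _ _) yr.
apply: (@le_trans _ _ (K + `|u c|)).
  by rewrite (le_trans (ler_normB _ _)) // lerD2r.
rewrite -[leLHS]add0r; apply: lerD; first exact: ltW.
rewrite -mulrA ler_peMr ?addr_ge0 // mulrC ler_pdivlMr ?exprn_gt0 // mul1r.
rewrite (bigD1 i) //= -[leLHS]addr0; apply: lerD.
  by rewrite -[leRHS]real_normK ?num_real // lerXn2r ?nnegrE // ltW.
by apply: sumr_ge0 => j _; apply: sqr_ge0.
Qed.

(** * Independence and identical laws under the integral *)

(* Fubini on the joint law, which is the product of the marginals. *)
Lemma independent_integral_mul0 (dT : measure_display) (T : measurableType dT)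
  (R : realType) (P : probability T R) (X Y : T -> R) :
  measurable_fun setT X -> measurable_fun setT Y ->
  (forall A B, measurable A -> measurable B ->
     P (X @^-1` A `&` Y @^-1` B) = (P (X @^-1` A) * P (Y @^-1` B))%E) ->
  P.-integrable setT (fun w => (X w * Y w)%:E) ->
  P.-integrable setT (fun w => (Y w)%:E) ->
  (\int[P]_w (Y w)%:E = 0)%E ->
  (\int[P]_w (X w * Y w)%:E = 0)%E.
Proof.
move=> mX mY XY iXY iY Y0.
have mpair : measurable_fun setT (fun w => (X w, Y w)).
  exact: measurable_fun_pair.
pose X' : {RV P >-> R} := HB.pack X (isMeasurableFun.Build _ _ _ _ X mX).
pose Y' : {RV P >-> R} := HB.pack Y (isMeasurableFun.Build _ _ _ _ Y mY).
pose Z' : {RV P >-> (R * R)%type} :=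
  HB.pack (fun w => (X w, Y w)) (isMeasurableFun.Build _ _ _ _ _ mpair).
pose f (z : R * R) := (z.1 * z.2)%:E.
have mf : measurable_fun [set: (R * R)%type] f.
  by apply/measurable_EFinP; apply: measurable_funM.
(* Agreement on rectangles determines the product measure, and on rectangles it is the independence
   hypothesis. *)
have joint : forall A, measurable A ->
    (distribution P X' \x distribution P Y')%E A = distribution P Z' A.
  by apply: product_measure_unique => A B mA mB; rewrite -XY.
transitivity (\int[distribution P Z']_z f z)%E.
  by rewrite integral_distribution.
rewrite (eq_measure_integral (distribution P X' \x distribution P Y')%E);
  last by move=> A mA _; symmetry; apply: joint.
have if_ : (distribution P X' \x distribution P Y')%E.-integrable setT f.
  apply/integrableP; split => //.
  have /integrableP[_] := iXY.
  rewrite (eq_measure_integral (distribution P Z')); last first.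
    by move=> A mA _; apply: joint.
  by rewrite ge0_integral_distribution //; apply: measurableT_comp.
(* For fixed [x] the inner integral is [x] times the mean of [Y], hence 0. *)
rewrite -integral12_prod_meas1 //= integral0_eq // => x _.
rewrite /fubini_F /f /=.
under eq_integral do rewrite EFinM.
have iY' : (distribution P Y').-integrable setT (EFin : R -> \bar R).
  exact: integrable_pushforward.
by rewrite integralZl // integral_distribution //= Y0 mule0.
Qed.

Lemma identical_integral_sqr (dT : measure_display) (T : measurableType dT)
  (R : realType) (P : probability T R) (X Y : T -> R) :
  measurable_fun setT X -> measurable_fun setT Y ->
  (forall B, measurable B -> P (X @^-1` B) = P (Y @^-1` B)) ->
  (\int[P]_w ((X w) ^+ 2)%:E = \int[P]_w ((Y w) ^+ 2)%:E)%E.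
Proof.
move=> mX mY XY.
pose X' : {RV P >-> R} := HB.pack X (isMeasurableFun.Build _ _ _ _ X mX).
pose Y' : {RV P >-> R} := HB.pack Y (isMeasurableFun.Build _ _ _ _ Y mY).
have mf : measurable_fun setT (fun r : R => (r ^+ 2)%:E).
  by apply/measurable_EFinP; apply: measurable_funX.
have sq0 (r : R) : (0 <= (r ^+ 2)%:E)%E by rewrite lee_fin sqr_ge0.
have := ge0_integral_distribution X' mf sq0.
have := ge0_integral_distribution Y' mf sq0.
move=> <- <-; apply: eq_measure_integral => A mA _; exact: XY.
Qed.

(** * Square-integrable functions and finite sums *)

(** Measurability is a separate clause because measurability of the square does not imply that of
    [f]. *)
Definition square_integrable (dT : measure_display) (T : measurableType dT)
  (R : realType) (P : probability T R) (f : T -> R) : Prop :=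
  measurable_fun setT f /\ P.-integrable setT (fun w => (f w ^+ 2)%:E).

(** The product is dominated by [f ^+ 2 + g ^+ 2]. *)
Lemma square_integrable_mul (dT : measure_display) (T : measurableType dT)
  (R : realType) (P : probability T R) (f g : T -> R) :
  square_integrable P f -> square_integrable P g ->
  P.-integrable setT (EFin \o (fun w => f w * g w)).
Proof.
move=> [mf f2] [mg g2].
apply: (le_integrable measurableT _ _ (integrableD measurableT f2 g2)).
  by apply/measurable_EFinP; apply: measurable_funM.
move=> w _ /=; rewrite lee_fin [leRHS]ger0_norm ?addr_ge0 ?sqr_ge0 //.
by rewrite ler_norml; apply/andP; split; nra.
Qed.

Lemma square_integrableD (dT : measure_display) (T : measurableType dT)
  (R : realType) (P : probability T R) (f g : T -> R) :
  square_integrable P f -> square_integrable P g ->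
  square_integrable P (fun w => f w + g w).
Proof.
move=> fP gP; have [mf f2] := fP; have [mg g2] := gP.
split; first exact: measurable_funD.
have fg := square_integrable_mul fP gP.
have := integrableD measurableT (integrableD measurableT f2 g2)
  (integrableZl measurableT 2%R fg).
apply: eq_integrable => // w _ /=.
by rewrite -EFinM -!EFinD; congr EFin; ring.
Qed.

Lemma square_integrableZ (dT : measure_display) (T : measurableType dT)
  (R : realType) (P : probability T R) (a : R) (f : T -> R) :
  square_integrable P f -> square_integrable P (fun w => a * f w).
Proof.
move=> [mf f2]; split; first exact: measurable_funM.
apply: eq_integrable (integrableZl measurableT (a ^+ 2)%R f2) => // w _ /=.
by rewrite -EFinM exprMn.
Qed.

Lemma square_integrable0 (dT : measure_display) (T : measurableType dT)
  (R : realType) (P : probability T R) : square_integrable P (fun=> 0).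
Proof.
split; first exact: measurable_cst.
by rewrite expr0n; apply: integrable0.
Qed.

Lemma square_integrable_sum (dT : measure_display) (T : measurableType dT)
  (R : realType) (P : probability T R) (I : Type) (S : seq I) (F : I -> T -> R) :
  (forall i, square_integrable P (F i)) ->
  square_integrable P (fun w => \sum_(i <- S) F i w).
Proof.
move=> FP; elim: S => [|i S IH].
  by under eq_fun do rewrite big_nil; apply: square_integrable0.
by under eq_fun do rewrite big_cons; apply: square_integrableD.
Qed.

Lemma integrable_EFin_sum (dT : measure_display) (T : measurableType dT)
  (R : realType) (P : probability T R) (I : Type) (S : seq I) (F : I -> T -> R) :
  (forall i, P.-integrable setT (EFin \o F i)) ->
  P.-integrable setT (EFin \o (fun w => \sum_(i <- S) F i w)).
Proof.
move=> FP; have := integrable_sum measurableT S (P := xpredT) (fun i _ => FP i).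
by apply: eq_integrable => // w _ /=; rewrite sumEFin.
Qed.

Lemma Rintegral_sum (dT : measure_display) (T : measurableType dT)
  (R : realType) (P : probability T R) (I : Type) (S : seq I) (F : I -> T -> R) :
  (forall i, P.-integrable setT (EFin \o F i)) ->
  \int[P]_w (\sum_(i <- S) F i w) = \sum_(i <- S) \int[P]_w F i w.
Proof.
move=> FP; elim: S => [|i S IH].
  rewrite big_nil; under eq_Rintegral do rewrite big_nil.
  by rewrite Rintegral_cst // mul0r.
rewrite big_cons -IH -RintegralD //; last exact: integrable_EFin_sum.
by apply: eq_Rintegral => w _; rewrite big_cons.
Qed.

(** The difference of the two sides is the variance of [a] under the weights [p]. *)
Lemma Jensen_sqr (R : realType) (I : eqType) (S : seq I) (p a : I -> R) :
  (forall i, 0 <= p i) -> \sum_(i <- S) p i = 1 ->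
  (\sum_(i <- S) p i * a i) ^+ 2 <= \sum_(i <- S) p i * a i ^+ 2.
Proof.
move=> p0 p1; set m := \sum_(i <- S) p i * a i; rewrite -subr_ge0.
have -> : \sum_(i <- S) p i * a i ^+ 2 - m ^+ 2
    = \sum_(i <- S) p i * (a i - m) ^+ 2.
  transitivity (\sum_(i <- S) (p i * a i ^+ 2 + (- 2 * m) * (p i * a i)
      + m ^+ 2 * p i)); last by apply: eq_bigr => i _; ring.
  by rewrite !big_split /= -!mulr_sumr p1 -/m; ring.
by apply: sumr_ge0 => i _; rewrite mulr_ge0 ?sqr_ge0.
Qed.

(** * The noise and its second moment *)

(** This is the harness process started from the zero profile, driven by [xi] at times 1 to [t]. *)
Fixpoint noise (R : realType) (d : nat) (Om : Type) (S : seq 'rV[int]_d)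
  (p : 'rV[int]_d -> R) (xi : int -> 'rV[int]_d -> Om -> R) (t : nat)
  (x : 'rV[int]_d) (w : Om) : R :=
  if t is t'.+1
  then walk_avg S p (fun y => noise S p xi t' y w) x + xi (t'.+1)%:Z x w
  else 0.

Section noise.
Context (dT : measure_display) (T : measurableType dT) (R : realType)
  (P : probability T R) (d : nat) (S : seq 'rV[int]_d) (p : 'rV[int]_d -> R)
  (xi : int -> 'rV[int]_d -> T -> R) (v : R).
Hypothesis p_ge0 : forall x, 0 <= p x.
Hypothesis p_sum1 : \sum_(z <- S) p z = 1.
Hypothesis xi_square_integrable : forall t x, square_integrable P (xi t x).
Hypothesis xi_orthogonal : forall t s x y, t != s ->
  \int[P]_w (xi t x w * xi s y w) = 0.
Hypothesis xi_variance : forall t x, \int[P]_w (xi t x w ^+ 2) = v.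

Lemma noise_square_integrable t x : square_integrable P (noise S p xi t x).
Proof.
elim: t x => [|t IH] x /=; first exact: square_integrable0.
apply: square_integrableD => //; apply: square_integrable_sum => z.
exact: square_integrableZ.
Qed.

Lemma walk_avg_noise_square_integrable t x : square_integrable P
  (fun w => walk_avg S p (fun y => noise S p xi t y w) x).
Proof.
apply: square_integrable_sum => z; apply: square_integrableZ.
exact: noise_square_integrable.
Qed.

Lemma walk_avg_noise_mul t s x y :
  \int[P]_w (walk_avg S p (fun y => noise S p xi t y w) x * xi s y w) =
  \sum_(z <- S) p z * \int[P]_w (noise S p xi t (x + z) w * xi s y w).
Proof.
have iN z : P.-integrable setT (EFin \o
    (fun w => noise S p xi t (x + z) w * xi s y w)).
  by apply: square_integrable_mul => //; apply: noise_square_integrable.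
under eq_Rintegral do rewrite /walk_avg mulr_suml.
rewrite Rintegral_sum => [|z].
  apply: eq_bigr => z _; rewrite -RintegralZl //.
  by apply: eq_Rintegral => w _; rewrite mulrA.
apply: eq_integrable (integrableZl measurableT (p z) (iN z)) => // w _ /=.
by rewrite -EFinM mulrA.
Qed.

(** The noise at time [t] is linear in variables of times at most [t], each orthogonal to those of
    the later time [s]. *)
Lemma noise_future_orthogonal t s x y : (t < s)%N ->
  \int[P]_w (noise S p xi t x w * xi s%:Z y w) = 0.
Proof.
elim: t x => [|t IH] x ts /=.
  under eq_Rintegral do rewrite mul0r.
  by rewrite Rintegral_cst // mul0r.
under eq_Rintegral do rewrite mulrDl.
rewrite RintegralD //; [|apply: square_integrable_mul => //..]; last first.
  exact: walk_avg_noise_square_integrable.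
rewrite walk_avg_noise_mul xi_orthogonal ?addr0; last first.
  by rewrite eqz_nat neq_ltn ts.
by rewrite big1 // => z _; rewrite IH ?mulr0 // ltnW.
Qed.

(** Each step adds a term orthogonal to the past with second moment [v]. Within a time slice,
    Jensen's inequality bounds the spatial average whatever the correlations between sites. *)
Lemma noise_second_moment t x :
  \int[P]_w (noise S p xi t x w ^+ 2) <= t%:R * v.
Proof.
elim: t x => [|t IH] x /=.
  under eq_Rintegral do rewrite expr0n.
  by rewrite Rintegral_cst // !mul0r.
set A := fun w => walk_avg S p (fun y => noise S p xi t y w) x.
have AP : square_integrable P A by apply: walk_avg_noise_square_integrable.
have iA : P.-integrable setT (EFin \o (fun w => A w ^+ 2)) by case: AP.
have iAxi := square_integrable_mul AP (xi_square_integrable t.+1%:Z x).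
have iAxi2 : P.-integrable setT (EFin \o (fun w => 2 * (A w * xi t.+1%:Z x w))).
  exact: (integrableZl measurableT 2%R iAxi).
have ixi : P.-integrable setT (EFin \o (fun w => xi t.+1%:Z x w ^+ 2)).
  by case: (xi_square_integrable t.+1%:Z x).
have iN z : P.-integrable setT (EFin \o
    (fun w => p z * noise S p xi t (x + z) w ^+ 2)).
  have [_ iN] := noise_square_integrable t (x + z).
  exact: (integrableZl measurableT (p z) iN).
(* The cross term vanishes because [A] only involves the noise up to time [t]. *)
have -> : \int[P]_w (A w + xi t.+1%:Z x w) ^+ 2 =
    \int[P]_w (A w ^+ 2) + \int[P]_w (xi t.+1%:Z x w ^+ 2).
  transitivity (\int[P]_w (A w ^+ 2 + 2 * (A w * xi t.+1%:Z x w)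
     + xi t.+1%:Z x w ^+ 2)).
    by apply: eq_Rintegral => w _; ring.
  rewrite RintegralD //; last exact: (integrableD measurableT iA iAxi2).
  rewrite RintegralD // RintegralZl // walk_avg_noise_mul big1 ?mulr0 ?addr0 //.
  by move=> z _; rewrite noise_future_orthogonal ?mulr0.
rewrite xi_variance -natr1 mulrDl mul1r lerD2r.
apply: (@le_trans _ _ (\int[P]_w
    \sum_(z <- S) p z * noise S p xi t (x + z) w ^+ 2)).
  apply: le_Rintegral => //; first exact: integrable_EFin_sum.
  by move=> w _; apply: Jensen_sqr.
rewrite Rintegral_sum //.
have -> : t%:R * v = \sum_(z <- S) p z * (t%:R * v).
  by rewrite -mulr_suml p_sum1 mul1r.
apply: ler_sum => z _; rewrite RintegralZl //; last first.
  by have [] := noise_square_integrable t (x + z).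
by apply: ler_wpM2l.
Qed.

End noise.

(** * Deviation events: probability bound and measurability *)

Lemma Chebyshev_sqr (dT : measure_display) (T : measurableType dT)
  (R : realType) (P : probability T R) (f : T -> R) (a : R) :
  square_integrable P f -> 0 < a ->
  (P [set w | a <= `|f w|]%R <= ((\int[P]_w (f w ^+ 2)) / a ^+ 2)%:E)%E.
Proof.
move=> [mf if2] a0.
pose f' : {RV P >-> R} := HB.pack f (isMeasurableFun.Build _ _ _ _ f mf).
have mk : ((a ^+ 2)%:E * P [set w | a <= `|f w|]%R <=
    (\int[P]_w (f w ^+ 2))%:E)%E.
  rewrite fineK ?integrable_fin_num //.
  apply: le_trans (@markov _ _ _ P f' (fun r => r ^+ 2) a a0 _ _ _) _ => //.
  - by move=> r _; apply: sqr_ge0.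
  - by move=> r s; rewrite !nnegrE => r0 s0 rs; rewrite lerXn2r ?nnegrE.
  rewrite unlock le_eqVlt; apply/orP; left; apply/eqP.
  by apply: eq_integral => w _ /=; rewrite real_normK ?num_real.
by rewrite mulrC EFinM lee_pdivlMl ?exprn_gt0.
Qed.

Lemma measurable_norm_ge (dT : measure_display) (T : measurableType dT)
  (R : realType) (f : T -> R) (a : R) :
  measurable_fun setT f -> measurable [set w | a <= `|f w|].
Proof.
move=> mf; have mn : measurable_fun setT (Num.norm \o f).
  exact: measurableT_comp.
have := mn measurableT _ (measurable_itv `[a, +oo[).
by rewrite setTI preimage_itvcy.
Qed.

(* For each index [i], the values of [g i] making some deviation exceed [r]
   form an open set, so an uncountable [D] causes no difficulty. *)
Lemma measurable_ereal_sup_dist (dT : measure_display) (T : measurableType dT)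
  (R : realType) (V : Type) (I : countType) (k : V -> I) (g : I -> T -> R)
  (u : V -> R) (D : set V) (a : R) :
  (forall i, measurable_fun setT (g i)) ->
  measurable_fun setT (fun w =>
    ereal_sup [set (`|a * g (k x) w - u x|)%:E | x in D]).
Proof.
move=> mg; apply: (measurability _ (ErealGenOInfty.measurableE R)).
move=> _ [_ [r ->] <-]; rewrite setTI.
pose O i := \bigcup_(x in [set x | D x /\ k x = i])
  ((fun c : R => `|a * c - u x|) @^-1` [set s | r < s]).
(* A point [x] enters [g] only through [k x], so grouping [D] by the fibres of [k] leaves a
   countable union. *)
rewrite [X in measurable X](_ : _ = \bigcup_i (g i @^-1` O i)).
  apply: countable_bigcupT_measurable => // i.
  rewrite -[X in measurable X]setTI; apply: mg => //.
  apply: open_measurable; apply: bigcup_open => x _.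
  apply: open_comp; last exact: open_gt.
  move=> c _; apply: cvg_norm; apply: cvgB; last exact: cvg_cst.
  by apply: cvgM; [exact: cvg_cst|exact: cvg_id].
rewrite preimage_itvoy; apply/seteqP; split => w /=.
  move/ereal_sup_gtP => [_ [x Dx <-]]; rewrite lte_fin => rx.
  by exists (k x) => //; exists x.
move=> [i _ [x [Dx xi] /= rx]]; apply/ereal_sup_gtP.
by exists (`|a * g (k x) w - u x|)%:E; [exists x|rewrite lte_fin xi].
Qed.

(** * Pathwise splitting of the harness process *)

Lemma harness_walk_noise (R : realType) (d : nat) (Om : Type)
  (S : seq 'rV[int]_d) (p : 'rV[int]_d -> R) (xi : int -> 'rV[int]_d -> Om -> R)
  (h : nat -> 'rV[int]_d -> Om -> R) t x w :
  (forall t x w,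
     h t.+1 x w = walk_avg S p (fun y => h t y w) x + xi (t.+1)%:Z x w) ->
  h t x w = iter t (walk_avg S p) (fun y => h 0%N y w) x + noise S p xi t x w.
Proof.
move=> hS; elim: t x => [|t IH] x /=; first by rewrite addr0.
by rewrite hS addrA -walk_avgD; congr (_ + _); apply: walk_avg_eq.
Qed.

Lemma harness_measurable (dT : measure_display) (T : measurableType dT)
  (R : realType) (d : nat) (S : seq 'rV[int]_d) (p : 'rV[int]_d -> R)
  (xi : int -> 'rV[int]_d -> T -> R) (h : nat -> 'rV[int]_d -> T -> R) t x :
  (forall t x, measurable_fun setT (xi t x)) ->
  (forall x, measurable_fun setT (h 0%N x)) ->
  (forall t x w,
     h t.+1 x w = walk_avg S p (fun y => h t y w) x + xi (t.+1)%:Z x w) ->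
  measurable_fun setT (h t x).
Proof.
move=> mxi mh hS; elim: t x => [//|t IH] x.
rewrite (_ : h t.+1 x = fun w =>
  walk_avg S p (fun y => h t y w) x + xi (t.+1)%:Z x w); last exact/funext.
apply: measurable_funD => //; apply: measurable_sum => z.
exact: measurable_funM.
Qed.

(** * The deterministic hydrodynamic limit *)

Lemma seq_coord_bound (R : realType) (d : nat) (S : seq 'rV[int]_d) :
  exists2 M : R, 0 <= M &
    forall z i, z \in S -> `|(z ord0 i)%:~R| <= M.
Proof.
elim: S => [|z S [M M0 SM]]; first by exists 0.
exists (\sum_j `|(z ord0 j)%:~R| + M).
  by rewrite addr_ge0 // sumr_ge0.
move=> y i; rewrite inE => /predU1P[->|/SM yM].
  rewrite (bigD1 i) //= -addrA lerDl addr_ge0 // sumr_ge0 //.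
by rewrite (le_trans (yM i)) // lerDr sumr_ge0.
Qed.

(** Applied to [n] times the rescaled site, this lets control at real points reach every lattice
    site. *)
Lemma floor_vecK (R : realType) (d : nat) (y : 'rV[int]_d) :
  floor_vec (map_mx intr y : 'rV[R]_d) = y.
Proof. by apply/matrixP => i j; rewrite !mxE intrKfloor. Qed.

Lemma norm_floor_sub_le1 (R : realType) (r : R) :
  `|(Num.floor r)%:~R - r| <= 1.
Proof.
have := floor_le_tmp r; have := floorD1_gt r.
by rewrite intrD ler_norml => ? ?; apply/andP; split; lra.
Qed.

Lemma norm_truncn_sub_le1 (R : realType) (r : R) : 0 <= r ->
  `|(Num.truncn r)%:R - r| <= 1.
Proof.
move=> r0; have /andP[] := truncn_itv r0; rewrite -natr1 ler_norml => ? ?.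
by apply/andP; split; lra.
Qed.

(** Here [r] and [N] do not depend on [g], so the estimate applies to each realisation of the
    initial profile. One [e] pays for the initial error, one for continuity of [u], one for the
    quadratic term. *)
Lemma walk_avg_hydrodynamics (R : realType) (d : nat) (S : seq 'rV[int]_d)
  (p : 'rV[int]_d -> R) (u : 'rV[R]_d -> R) (m : 'rV[R]_d) (x : 'rV[R]_d)
  (t e : R) :
  (forall z, 0 <= p z) -> \sum_(z <- S) p z = 1 ->
  (forall i, m ord0 i = walk_mean S p i) ->
  continuous u -> 0 <= t -> 0 < e ->
  exists (r : R) (N : nat), forall n (g : 'rV[int]_d -> R), (N < n)%N ->
    (forall y : 'rV[R]_d, `|y| <= r ->
       `|n%:R^-1 * g (floor_vec (n%:R *: y)) - u y| < e) ->
    `|n%:R^-1 * iter (Num.truncn (n%:R * t)) (walk_avg S p) g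
        (floor_vec (n%:R *: x)) - u (x + t *: m)| < 3 * e.
Proof.
move=> p0 p1 mE cu t0 e0.
have [M M0 SM] := seq_coord_bound R S.
(* After rescaling, rounding the starting point costs at most 1 and the walk travels at most
   [t * M]. *)
pose r := `|x| + 1 + t * M.
have [B B0 uB] := continuous_le_sqr (x + t *: m) r cu e0.
(* Per coordinate, the bias left at scale [n] consists of two rounding errors, of [n%:R * x] and of
   [n%:R * t]; the variance grows at most like [n%:R * t]. *)
pose C := \sum_i ((1 + `|m ord0 i|) ^+ 2 + t * `|walk_var S p i|).
exists r, (Num.bound (B * C / e)) => n g Nn gu.
have n1 : 1 <= n%:R :> R by rewrite ler1n (leq_ltn_trans _ Nn).
have n0 : 0 < n%:R :> R by exact: lt_le_trans n1.
set n' := Num.truncn _; set X := floor_vec _.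
have n't : n'%:R <= n%:R * t by rewrite truncn_le mulr_ge0 // ltW.
have gL (y : 'rV[int]_d) :
    (forall i, `|(y ord0 i)%:~R - (X ord0 i)%:~R| <= n'%:R * M) ->
    `|n%:R^-1 * g y - u (x + t *: m)| <= 2 * e + B / n%:R ^+ 2 *
      \sum_i ((y ord0 i)%:~R - n%:R * (x + t *: m) ord0 i) ^+ 2.
  move=> yX; pose y' : 'rV[R]_d := n%:R^-1 *: map_mx intr y.
  have y'r : `|y'| <= r.
    apply: norm_rV_le => [|i]; first by rewrite !addr_ge0 // mulr_ge0.
    rewrite !mxE normrM normfV (ger0_norm (ltW n0)) mulrC ler_pdivrMr //.
    have := yX i; have := norm_floor_sub_le1 (n%:R * x ord0 i).
    have : `|n%:R * x ord0 i| <= n%:R * `|x|.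
      by rewrite normrM (ger0_norm (ltW n0)) ler_wpM2l ?norm_coord_le // ltW.
    have : n'%:R * M <= n%:R * t * M by apply: ler_wpM2r.
    rewrite !mxE !ler_norml => ? /andP[? ?] /andP[? ?] /andP[? ?].
    by rewrite /r; apply/andP; split; nra.
  have := gu _ y'r.
  rewrite /y' scalerA divff ?gt_eqF // scale1r floor_vecK -/y'.
  move=> /ltW g1; have g2 := uB _ y'r.
  (* The intermediate value [u y'] separates the initial error from the oscillation of [u]. *)
  rewrite (_ : _ - _ = (n%:R^-1 * g y - u y') + (u y' - u (x + t *: m)));
    last by rewrite addrA subrK.
  apply: (le_trans (ler_normD _ _)); apply: (le_trans (lerD g1 g2)).
  rewrite addrA (_ : e + e = 2 * e); last by ring.
  rewrite lerD2l -mulrA ler_wpM2l //.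
  rewrite mulr_sumr; apply: ler_sum => i _; rewrite -exprVn -exprMn.
  by rewrite mulrBr mulKf ?gt_eqF // !mxE.
have := iter_walk_avg_dist p0 p1 SM gL; rewrite iter_walk_avgZ.
move=> /le_lt_trans; apply.
rewrite (_ : 3 * e = 2 * e + e); last by ring.
rewrite ltrD2l.
apply: (@le_lt_trans _ _ (B / n%:R ^+ 2 * (n%:R * C))).
  apply: ler_wpM2l; first by rewrite divr_ge0 // sqr_ge0.
  rewrite mulr_sumr; apply: ler_sum => i _; rewrite [leRHS]mulrDr; apply: lerD.
    (* The squared bias is bounded independently of [n], and [n >= 1] supplies the factor [n%:R]. *)
    apply: (@le_trans _ _ ((1 + `|m ord0 i|) ^+ 2)); last first.
      by rewrite ler_peMl ?sqr_ge0.
    rewrite -[leLHS]real_normK ?num_real // lerXn2r ?nnegrE ?addr_ge0 //.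
    rewrite !mxE -mE.
    rewrite (_ : _ - _ = ((Num.floor (n%:R * x ord0 i))%:~R - n%:R * x ord0 i)
      + (n'%:R - n%:R * t) * m ord0 i); last by ring.
    apply: (le_trans (ler_normD _ _)); apply: lerD.
      exact: norm_floor_sub_le1.
    rewrite normrM ler_piMl // norm_truncn_sub_le1 // mulr_ge0 // ltW.
  apply: (@le_trans _ _ (n'%:R * `|walk_var S p i|)).
    by rewrite ler_wpM2l ?ler_norm.
  by rewrite mulrA ler_wpM2r.
(* Dividing by the square of [n] leaves order [1/n], and [N] was chosen to bring this below [e]. *)
rewrite (_ : _ * _ = B * C / n%:R); last by field; rewrite gt_eqF.
rewrite ltr_pdivrMr // [ltRHS]mulrC -ltr_pdivrMr //.
apply: (@lt_trans _ _ (Num.bound (B * C / e))%:R); last by rewrite ltr_nat.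
apply: archi_boundP; apply: divr_ge0 (ltW e0); apply: mulr_ge0 => //.
by apply: sumr_ge0 => i _; rewrite addr_ge0 ?sqr_ge0 // mulr_ge0.
Qed.

Theorem theorem2p1 (R : realType) (dT : measure_display) (T : measurableType dT)
  (P : probability T R) (d : nat) (p : 'rV[int]_d -> R)
  (xi : int -> 'rV[int]_d -> T -> R)
  (h : nat -> nat -> 'rV[int]_d -> T -> R)
  (u0 : 'rV[R]_d -> R) :
  (forall x, 0 <= p x < 1) ->
  (\sum_(x \in [set: 'rV[int]_d]) p x)%R = 1 ->
  (exists M : nat, forall x : 'rV[int]_d, (exists i, (M%:Z < `|x ord0 i|)%R) -> p x = 0) ->
  strongly_aperiodic p ->
  (forall t x, measurable_fun setT (xi t x)) ->
  mutually_independent P (fun tx : int * 'rV[int]_d => xi tx.1 tx.2) ->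
  identically_distributed P (fun tx : int * 'rV[int]_d => xi tx.1 tx.2) ->
  (forall t x, P.-integrable setT (fun w => (xi t x w)%:E)) ->
  (forall t x, (\int[P]_w (xi t x w)%:E = 0)%E) ->
  (forall t x, P.-integrable setT (fun w => ((xi t x w) ^+ 2)%:E)) ->
  (forall n x, measurable_fun setT (h n 0%N x)) ->
  (forall n, independent_families P
     (fun sx : nat * 'rV[int]_d => xi (sx.1.+1)%:Z sx.2) (h n 0%N)) ->
  (forall n t x w, h n t.+1 x w = harness_step p (fun y => h n t y w) x + xi (t.+1)%:Z x w) ->
  continuous u0 ->
  (forall (eps : R) (Rad : R), 0 < eps ->
     (fun n : nat => P [set w | (ereal_sup
        [set ((`| n%:R^-1 * h n 0%N (floor_vec (n%:R *: x)) w - u0 x |)%R)%:E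
           | x in [set x : 'rV[R]_d | (`|x| <= Rad)%R]] >= eps%:E)%E])
       @ \oo --> 0%E) ->
  forall (eps : R) (t : R) (x : 'rV[R]_d), 0 < eps -> 0 <= t ->
    (fun n : nat => P [set w |
        `| n%:R^-1 * h n (Num.truncn (n%:R * t)) (floor_vec (n%:R *: x)) w
           - u0 (x + t *: mean_vec p) | >= eps])
      @ \oo --> 0%E.
Proof.
move=> p01 psum _ _ mxi indep ident ixi xi0 ixi2 mh _ hS cu h0 eps t x eps0 t0.
have [S [uS pS pS1]] := fsum1_support psum.
have p0 z : 0 <= p z by have /andP[] := p01 z.
have {}hS n t' x' w : h n t'.+1 x' w =
    walk_avg S p (fun y => h n t' y w) x' + xi (t'.+1)%:Z x' w.
  by rewrite hS (harness_stepE _ _ uS pS).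
have sqxi s y : square_integrable P (xi s y) by split.
have orth s s' y y' : s != s' -> \int[P]_w (xi s y w * xi s' y' w) = 0.
  move=> ss'; rewrite /Rintegral.
  rewrite (independent_integral_mul0 (mxi s y) (mxi s' y')) //; last first.
    exact: square_integrable_mul.
  move=> A B mA mB.
  have neq : ((s', y') == (s, y)) = false.
    by rewrite xpair_eqE eq_sym (negbTE ss').
  (* The family of events is indexed by all sites; only its values at the two listed, distinct
     indices matter. *)
  have := indep [:: (s, y); (s', y')] (fun i => if i == (s, y) then A else B).
  rewrite /= inE eq_sym neq !big_cons big_nil eqxx neq mule1 => <- //.
    congr (P _); apply/seteqP; split => w /=.
      move=> [Aw Bw] i; rewrite !inE => /orP[]/eqP -> /=.
        by rewrite eqxx.
      by rewrite neq.
    move=> AB; split.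
      by have := AB (s, y); rewrite inE !eqxx; apply.
    by have := AB (s', y'); rewrite !inE eqxx orbT neq; apply.
  by move=> i; case: ifP.
pose v := \int[P]_w (xi 0 0 w ^+ 2).
have var s y : \int[P]_w (xi s y w ^+ 2) = v.
  congr fine; apply: identical_integral_sqr => // A mA.
  exact: (ident (s, y) (0, 0)).
have v0 : 0 <= v by apply: Rintegral_ge0 => w _; apply: sqr_ge0.
(* The deterministic estimate loses a factor 3, giving [eps / 2]; the other half is left for the
   noise. *)
have e0 : 0 < eps / 6 by rewrite divr_gt0.
have [r [N hyd]] := walk_avg_hydrodynamics x p0 pS1
  (fun i => mean_vecE i uS pS) cu t0 e0.
move: (h0 (eps / 6) r e0); set E1 := (X in X @ _ --> _) => h1.
(* Chebyshev's inequality gives [t * v / (eps / 2) ^+ 2] over [n]; the factor 2 replaces [1/n] by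
   [1/(n+1)], the harmonic sequence, for [n >= 1]. *)
pose K := 2 * (t * v / (eps / 2) ^+ 2).
have K0 : 0 <= K by rewrite mulr_ge0 // divr_ge0 ?sqr_ge0 // mulr_ge0.
have bnd n : (N < n)%N -> (P [set w |
    (eps <= `|n%:R^-1 * h n (Num.truncn (n%:R * t)) (floor_vec (n%:R *: x)) w -
       u0 (x + t *: mean_vec p)|)%R] <= E1 n + (K * n.+1%:R^-1)%:E)%E.
  move=> Nn; rewrite /E1; set T1 := [set w | (_ >= _)%E].
  set n' := Num.truncn _; set X := floor_vec _.
  have n1 : 1 <= n%:R :> R by rewrite ler1n (leq_ltn_trans _ Nn).
  have n0 : 0 < n%:R :> R by exact: lt_le_trans n1.
  have mT1 : measurable T1.
    have := measurable_ereal_sup_dist (fun y : 'rV[R]_d => floor_vec (n%:R *: y))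
      u0 [set y | `|y| <= r] n%:R^-1 (mh n).
    by move/(emeasurable_fun_c_infty measurableT)/(_ (eps / 6)%:E); rewrite setTI.
  have sqN := noise_square_integrable S p sqxi n' X.
  pose T2 := [set w | n%:R * (eps / 2) <= `|noise S p xi n' X w|].
  have mT2 : measurable T2 by apply: measurable_norm_ge; case: sqN.
  have T2le : (P T2 <= (K * n.+1%:R^-1)%:E)%E.
    apply: le_trans (Chebyshev_sqr sqN _) _; first by rewrite mulr_gt0 ?divr_gt0.
    rewrite lee_fin ler_pdivrMr ?exprn_gt0 ?mulr_gt0 ?divr_gt0 //.
    apply: le_trans (noise_second_moment p0 pS1 sqxi orth var n' X) _.
    apply: (@le_trans _ _ (n%:R * t * v)).
      by rewrite ler_wpM2r // truncn_le mulr_ge0 // ltW.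
    rewrite (_ : _ * (_ * _) ^+ 2 = n%:R * t * v * (2 * n%:R / n.+1%:R)); last first.
      by rewrite /K; field; rewrite !gt_eqF // addr_gt0.
    rewrite ler_peMr ?mulr_ge0 ?(ltW n0) // ler_pdivlMr // -natr1; lra.
  (* Union bound: a deviation of [eps] forces a bad initial profile, [T1], or a large noise,
     [T2]. *)
  apply: (@le_trans _ _ (P (T1 `|` T2))); last first.
    apply: (@le_trans _ _ (P T1 + P T2)%E); first exact: measureU2.
    exact: leeD2l.
  apply: le_measure; rewrite ?inE; [|exact: measurableU|].
    apply: measurable_norm_ge; apply: measurable_funB => //.
    apply: measurable_funM => //.
    exact: harness_measurable (mh n) (hS n).
  move=> w /= epsw; have [T1w|/negP] := pselect (T1 w); first by left.
  rewrite -ltNge => supw; right; rewrite /T2 /=.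
  (* Outside [T1] the initial profile of this [w] is uniformly close to [u0] on the ball, so the
     deterministic estimate applies to it. *)
  have := hyd n (fun y => h n 0%N y w) Nn; rewrite -/n' -/X => hydw.
  have {}hydw := hydw _.
  move: epsw; rewrite (harness_walk_noise n' X w (hS n)).
  set D := iter _ _ _ _ in hydw *.
  rewrite mulrDr addrAC => /le_trans/(_ (ler_normD _ _)).
  rewrite normrM normfV (ger0_norm (ltW n0)) => epsw.
  rewrite mulrC -ler_pdivlMr // [leRHS]mulrC.
  suff : `|n%:R^-1 * D - u0 (x + t *: mean_vec p)| < 3 * (eps / 6) by lra.
  apply: hydw => y yr; rewrite -lte_fin; apply: le_lt_trans supw.
  by apply: ereal_sup_ubound; exists y.
apply: (@squeeze_cvge _ _ _ _ (fun=> 0%E) _ (fun n => E1 n + (K * n.+1%:R^-1)%:E)%E).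
- by near=> n; rewrite measure_ge0 /= bnd //; near: n; exists N.+1.
- exact: cvg_cst.
- rewrite -[X in _ --> X]adde0; apply: cvgeD => //.
  apply: cvg_EFin; first by near=> n.
  rewrite -[X in _ --> X](mulr0 K); apply: cvgMr.
  exact: cvg_harmonic.
Unshelve. all: by end_near.
Qed.
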